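(* Let $d$ be a positive integer, $w_1,w_2,\dots$ an infinite sequence of non-negative integers and $u$ a positive integer. Then the polynomials $s^w_\lambda(x)$, $\lambda\in\mathcal{P}(d)$, form a $\mathbb{Q}$-basis of $\mathbb{Q}[x]^{\mathfrak{S}_d}$.
   Context: $\mathcal{P}(d)$ is the set of partitions $\lambda=(\lambda_1\ge\dots\ge\lambda_d\ge0)$ with at most $d$ rows; put $\bar\lambda_i=\lambda_i+d+1-i$. $\mathbb{Q}[x]^{\mathfrak{S}_d}$ is the ring of symmetric polynomials in $x_1,\dots,x_d$ with rational coefficients. The factorial Schur polynomial in $x_1,\dots,x_d$ and indeterminates $a=(a_1,a_2,\dots)$ is $$s_\lambda(x|a)=\frac{\det\big[\prod_{p=1}^{\bar\lambda_i-1}(x_j-a_p)\big]_{1\le i,j\le d}}{\prod_{1\le i<j\le d}(x_i-x_j)}.$$ The twisted Schur polynomial $s^w_\lambda(x)\in\mathbb{Q}[x]^{\mathfrak{S}_d}$ is obtained from $s_\lambda(x|a)$ by substituting $a_l=-(w_l/u)(x_1+\dots+x_d)$ for all $l\ge1$. *)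

(* Defs.v *)
From Stdlib Require Import ClassicalEpsilon.
From mathcomp Require Import all_boot all_order all_fingroup all_algebra.
From mathcomp Require Import finmap.
From mathcomp Require Import -(notations) monalg.
From mathcomp Require Import mpoly.

Set Implicit Arguments.
Unset Strict Implicit.
Unset Printing Implicit Defensive.

Import GRing.Theory.
Local Open Scope ring_scope.

Definition part (d : nat) := {la : d.-tuple nat | sorted geq la}.

(* With 0-based i this is the usual la_i + d + 1 - i for 1 <= i <= d. *)
Definition bar_part (d : nat) (la : part d) (i : 'I_d) : nat :=
  (tnth (val la) i + (d - i))%N.

(* Polynomials in the infinitely many indeterminates a_l. The index l is a nat
   and keeps its usual 1-based meaning, so that a_0 is never used below. *)
Notation apoly := (malg (cmonom nat) rat).

Definition avar (l : nat) : apoly := mkmalgU (ucm l) 1.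

Definition aeval (S : comAlgType rat) (v : nat -> S) (p : apoly) : S :=
  monalg.mmap (in_alg S)
    (fun m : cmonom nat => \prod_(l <- finsupp m) v l ^+ m l) p.

Definition xsubst (R S : comNzRingType) (d : nat) (f : R -> {mpoly S[d]})
    (p : {mpoly R[d]}) : {mpoly S[d]} :=
  mpoly.mmap f (fun i : 'I_d => 'X_i) p.

(* The quotient f / g, unique when g divides f and g is not a zero divisor. The
   Vandermonde product, the only g used below, is not a zero divisor. *)
Definition exact_quo (R : comNzRingType) (f g : R) : R :=
  epsilon (inhabits 0) (fun q => q * g = f).

Definition vdm (R : comNzRingType) (d : nat) : {mpoly R[d]} :=
  \prod_(i < d) \prod_(j < d | (i < j)%N) ('X_i - 'X_j).

Definition factorial_schur (d : nat) (la : part d) : {mpoly apoly[d]} :=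
  exact_quo
    (\det (\matrix_(i < d, j < d)
             \prod_(1 <= p < bar_part la i) ('X_j - (avar p)%:MP)))
    (vdm apoly d).

Definition twisted_schur (d : nat) (w : nat -> nat) (u : nat) (la : part d) :
    {mpoly rat[d]} :=
  xsubst (aeval (fun l : nat => - ((w l)%:R / u%:R) *: \sum_(k < d) 'X_k))
         (factorial_schur la).

Definition is_basis (K : fieldType) (V : lmodType K) (S : {pred V})
    (I : eqType) (b : I -> V) : Prop :=
  [/\ forall i, b i \in S,
      forall (r : seq I) (c : I -> K), uniq r ->
        \sum_(i <- r) c i *: b i = 0 -> forall i, i \in r -> c i = 0
    & forall v, v \in S ->
        exists (r : seq I) (c : I -> K), v = \sum_(i <- r) c i *: b i].

(* Main.v *)
Require Import Defs.
From HB Require Import structures.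
From Stdlib Require Import ClassicalEpsilon.
From mathcomp Require Import all_boot all_order all_fingroup all_algebra.
From mathcomp Require Import finmap.
From mathcomp Require Import -(notations) monalg.
From mathcomp Require Import mpoly.
From mathcomp Require Import zify.

(** Multiplied by the Vandermonde product, the twisted Schur polynomial of
    [la] becomes the alternant [D_b = det [(x_j|a)^(b_i)]], where [(x|a)^k] is
    the product of the [x - a_p], [p <= k], where [b_i = bar_part la i - 1] and
    [a_l = - (w_l / u) e_1], [e_1] being the sum of the [x_k].  From
    [x (x|a)^k = (x|a)^(k+1) + a_(k+1) (x|a)^k] one gets the Pieri rule
    [(1 + \sum_i w_(b_i + 1) / u) e_1 D_b = \sum_i D_(b + eps_i)].  As [w] is
    nonnegative, the factor on the left is not zero, hence the span of the
    twisted polynomials is stable under multiplication by [e_1].  Trading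
    powers of [x] for factorial powers row by row, one finds that every
    alternant [det [x_j^(m_i)]] is the Vandermonde product times an element of
    this span, which therefore contains all symmetric polynomials.
    In each degree there are as many twisted polynomials as Schur polynomials,
    and the latter are independent and in the span of the former, so the
    twisted polynomials are independent as well. *)

Set Implicit Arguments.
Unset Strict Implicit.
Unset Printing Implicit Defensive.

Import Order.TTheory GRing.Theory Num.Theory.
Local Open Scope ring_scope.

(** * Alternants and the Vandermonde product *)

Definition alternant (R : comNzRingType) (d : nat)
    (f : 'I_d -> {poly {mpoly R[d]}}) : {mpoly R[d]} :=
  \det (\matrix_(i < d, j < d) (f i).['X_j]).

(** The factors of [det_Vandermonde] are opposite to those of [vdm]. Their total sign is kept as a
    product of the same shape, so that the two merge factor by factor. *)
Definition vdm_sign (R : comNzRingType) (d : nat) : {mpoly R[d]} :=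
  \prod_(i < d) \prod_(j < d | (i < j)%N) (-1).

Lemma vdm_signK (R : comNzRingType) (d : nat) : vdm_sign R d * vdm_sign R d = 1.
Proof.
rewrite -big_split big1 //= => i _; rewrite -big_split big1 //= => j _.
by rewrite mulrNN mulr1.
Qed.

Lemma det_Vandermonde_vdm (R : comNzRingType) (d : nat) :
  \det (Vandermonde d (\row_(k < d) ('X_k : {mpoly R[d]}))) =
  vdm_sign R d * vdm R d.
Proof.
rewrite det_Vandermonde -big_split; apply: eq_bigr => i _ /=.
rewrite -big_split; apply: eq_bigr => j _ /=.
by rewrite !mxE mulN1r opprB.
Qed.

(* Only the remainders of the [f i] modulo [\prod_k ('X - x_k)] matter. *)
Lemma horner_matrix_Vandermonde (T : comNzRingType) (d : nat) (x : 'I_d -> T)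
    (f : 'I_d -> {poly T}) :
  exists C, \matrix_(i < d, j < d) (f i).[x j] =
            C *m Vandermonde d (\row_(k < d) x k).
Proof.
pose P : {poly T} := \prod_(k < d) ('X - (x k)%:P).
have monP : P \is monic by apply: monic_prod_XsubC.
have szP : size P = d.+1.
  by rewrite size_prod_XsubC [index_enum _]unlock -enumT size_enum_ord.
pose r i := Pdiv.Ring.rmodp (f i) P.
have szr i : (size (r i) <= d)%N.
  by rewrite -ltnS -szP Pdiv.Ring.ltn_rmodpN0 ?monic_neq0.
have fr i j : (f i).[x j] = \sum_(k < d) (r i)`_k * x j ^+ k.
  rewrite (Pdiv.RingMonic.rdivp_eq monP (f i)) hornerD hornerM.
  have -> : P.[x j] = 0.
    by rewrite horner_prod (bigD1 j) //= hornerXsubC subrr mul0r.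
  by rewrite mulr0 add0r (horner_coef_wide _ (szr i)).
exists (\matrix_(i < d, k < d) (r i)`_k).
apply/matrixP=> i j; rewrite !mxE fr; apply: eq_bigr => k _.
by rewrite !mxE.
Qed.

Lemma vdm_dvd_alternant (R : comNzRingType) (d : nat)
    (f : 'I_d -> {poly {mpoly R[d]}}) :
  exists q, q * vdm R d = alternant f.
Proof.
have [C fC] := horner_matrix_Vandermonde (fun k => 'X_k : {mpoly R[d]}) f.
exists (\det C * vdm_sign R d).
by rewrite -mulrA -det_Vandermonde_vdm -det_mulmx -fC.
Qed.

(** Scaling row [i] multiplies the Leibniz term of [s] by [x (s i)], and the sum of these over [i]
    does not depend on [s]. *)
Lemma det_sum_scale_row (R : comNzRingType) (n : nat) (M : 'M[R]_n)
    (x : 'I_n -> R) :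
  \sum_i \det (\matrix_(k, j) ((if k == i then x j else 1) * M k j)) =
  (\sum_j x j) * \det M.
Proof.
rewrite /determinant exchange_big mulr_sumr; apply: eq_bigr => s _ /=.
have -> : \sum_j x j = \sum_j x (s j) by apply: reindex_inj; apply: perm_inj.
rewrite -mulr_sumr mulrCA; congr (_ * _).
rewrite mulr_suml; apply: eq_bigr => i _.
under eq_bigr => k _ do rewrite mxE.
rewrite big_split /= (bigD1 i) //= eqxx big1 ?mulr1 // => k.
by move/negbTE->.
Qed.

Definition upd (T : Type) (d : nat) (f : 'I_d -> T) (i : 'I_d) (t : T) :=
  fun k => if k == i then t else f k.

Lemma alternant_sum_mulX (R : comNzRingType) (d : nat)
    (f : 'I_d -> {poly {mpoly R[d]}}) :
  \sum_i alternant (upd f i ('X * f i)) = (\sum_(j < d) 'X_j) * alternant f.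
Proof.
rewrite -det_sum_scale_row; apply: eq_bigr => i _; congr (\det _).
apply/matrixP=> k j; rewrite !mxE /upd; case: eqP => [->|_].
  by rewrite hornerM hornerX.
by rewrite mul1r.
Qed.

Lemma eq_alternant (R : comNzRingType) (d : nat)
    (f g : 'I_d -> {poly {mpoly R[d]}}) : f =1 g -> alternant f = alternant g.
Proof.
by move=> fg; congr (\det _); apply/matrixP=> i j; rewrite !mxE fg.
Qed.

Lemma alternant_upd_linear (R : comNzRingType) (d : nat)
    (f : 'I_d -> {poly {mpoly R[d]}}) (i : 'I_d) (a : {mpoly R[d]})
    (p q : {poly {mpoly R[d]}}) :
  alternant (upd f i (p + a%:P * q)) =
  alternant (upd f i p) + a * alternant (upd f i q).
Proof.
rewrite -[alternant (upd f i p)]mul1r.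
apply: (@determinant_multilinear _ _ _ _ _ i).
- by apply/rowP=> j; rewrite !mxE /upd eqxx hornerD hornerM hornerC mul1r.
- by apply/matrixP=> k j; rewrite !mxE /upd eq_sym (negbTE (neq_lift _ _)).
- by apply/matrixP=> k j; rewrite !mxE /upd eq_sym (negbTE (neq_lift _ _)).
Qed.

Lemma alternant_perm (R : comNzRingType) (d : nat)
    (f : 'I_d -> {poly {mpoly R[d]}}) (s : 'S_d) :
  alternant (f \o s) = (-1) ^+ s * alternant f.
Proof.
rewrite -det_perm -det_mulmx -row_permE; congr (\det _).
by apply/matrixP=> i j; rewrite !mxE.
Qed.

Lemma alternant_dup (R : comNzRingType) (d : nat)
    (f : 'I_d -> {poly {mpoly R[d]}}) (i j : 'I_d) :
  i != j -> f i = f j -> alternant f = 0.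
Proof.
move=> ij fij; apply: (determinant_alternate ij) => k.
by rewrite !mxE fij.
Qed.

(** Once the coefficients are invariant, [msym s] only moves the evaluation points, that is,
    permutes the columns. *)
Lemma msym_alternant (R : comNzRingType) (d : nat) (s : 'S_d)
    (f : 'I_d -> {poly {mpoly R[d]}}) :
  (forall i, map_poly (msym s) (f i) = f i) ->
  msym s (alternant f) = (-1) ^+ s * alternant f.
Proof.
move=> fs; rewrite /alternant -det_map_mx.
rewrite -odd_permV -det_perm mulrC -det_mulmx -col_permE.
congr (\det _); apply/matrixP=> i j; rewrite !mxE -horner_map /= fs.
by rewrite /msym mmapX mmap1U.
Qed.

Lemma msym_vdm (R : comNzRingType) (d : nat) (s : 'S_d) :
  msym s (vdm R d) = (-1) ^+ s * vdm R d.
Proof.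
have vdmE : vdm R d =
    vdm_sign R d * alternant (fun k : 'I_d => 'X^k : {poly {mpoly R[d]}}).
  have -> : alternant (fun k : 'I_d => 'X^k : {poly {mpoly R[d]}}) =
            vdm_sign R d * vdm R d.
    rewrite -det_Vandermonde_vdm; congr (\det _).
    by apply/matrixP=> i j; rewrite !mxE hornerXn.
  by rewrite mulrA vdm_signK mul1r.
rewrite vdmE msymM msym_alternant => [|i]; last by rewrite map_polyXn.
rewrite mulrCA; congr (_ * (_ * _)).
rewrite rmorph_prod; apply: eq_bigr => i _ /=.
by rewrite rmorph_prod; apply: eq_bigr => j _; rewrite rmorphN1.
Qed.

(** * The substitutions as ring morphisms *)

Definition cmonom_eval (S : comNzRingType) (v : nat -> S) (m : cmonom nat) :
    S :=
  \prod_(l <- finsupp m) v l ^+ m l.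

Lemma cmonom_eval_wide (S : comNzRingType) (v : nat -> S) (m : cmonom nat)
    (D : {fset nat}) : (finsupp m `<=` D)%fset ->
  cmonom_eval v m = \prod_(l <- D) v l ^+ m l.
Proof.
move=> mD; apply: big_fset_incl => // l _ lm.
by rewrite (fsfun_dflt lm) expr0.
Qed.

Lemma cmonom_eval_mmorphism (S : comNzRingType) (v : nat -> S) :
  mmorphism (cmonom_eval v).
Proof.
split=> [m1 m2|]; last by rewrite /cmonom_eval mdom1 big_seq_fset0.
(* Both products are taken over the union of the supports, which is the support of the product
   monomial. *)
rewrite (cmonom_eval_wide v (fsubsetUl (finsupp m1) (finsupp m2))).
rewrite (cmonom_eval_wide v (fsubsetUr (finsupp m1) (finsupp m2))) -big_split.
rewrite /cmonom_eval mdomD; apply: eq_bigr => l _ /=.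
by rewrite cmM exprD.
Qed.

HB.instance Definition _ (S : comNzRingType) (v : nat -> S) :=
  monalg.isMultiplicative.Build _ _ (cmonom_eval v) (cmonom_eval_mmorphism v).

HB.instance Definition _ (S : comAlgType rat) (v : nat -> S) :=
  GRing.RMorphism.copy (aeval v) (monalg.mmap (in_alg S) (cmonom_eval v)).

HB.instance Definition _ (R S : comNzRingType) (d : nat)
    (f : {rmorphism R -> {mpoly S[d]}}) :=
  GRing.RMorphism.copy (xsubst (d := d) f)
    (mpoly.mmap f (fun i : 'I_d => 'X_i)).

Lemma aeval_avar (S : comAlgType rat) (v : nat -> S) (l : nat) :
  aeval v (avar l) = v l.
Proof.
rewrite /aeval /avar monalg.mmapU monalg.mdomU big_seq_fset1 monalg.cmUU.
by rewrite expr1 /= scale1r mul1r.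
Qed.

Lemma xsubstX (R S : comNzRingType) (d : nat)
    (f : {rmorphism R -> {mpoly S[d]}}) (i : 'I_d) :
  xsubst f 'X_i = 'X_i.
Proof. by rewrite /xsubst mpoly.mmapX mmap1U. Qed.

Lemma xsubstC (R S : comNzRingType) (d : nat)
    (f : {rmorphism R -> {mpoly S[d]}}) (c : R) :
  xsubst f (c%:MP : {mpoly R[d]}) = f c.
Proof. by rewrite /xsubst mpoly.mmapC. Qed.

(** * Factorial powers and the determinantal form of twisted polynomials *)

Definition fac_power (R : comNzRingType) (v : nat -> R) (b : nat) : {poly R} :=
  \prod_(1 <= p < b.+1) ('X - (v p)%:P).

Lemma horner_fac_power (R : comNzRingType) (v : nat -> R) (b : nat) (x : R) :
  (fac_power v b).[x] = \prod_(1 <= p < b.+1) (x - v p).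
Proof.
by rewrite horner_prod; apply: eq_bigr => p _; rewrite hornerXsubC.
Qed.

(** These are the entries of [la] plus the staircase [d-1, ..., 0]: the [i]-th row of the
    determinant has one factor fewer than [bar_part la i]. *)
Definition bar_exp (d : nat) (la : part d) (i : 'I_d) : nat :=
  (bar_part la i).-1.

Definition twist (d : nat) (w : nat -> nat) (u l : nat) : {mpoly rat[d]} :=
  - ((w l)%:R / u%:R) *: \sum_(k < d) 'X_k.

Lemma bar_expS (d : nat) (la : part d) (i : 'I_d) :
  (bar_exp la i).+1 = bar_part la i.
Proof.
by rewrite /bar_exp prednK // /bar_part addn_gt0 subn_gt0 ltn_ord orbT.
Qed.

Lemma exact_quoK (R : comNzRingType) (f g : R) :
  (exists q, q * g = f) -> exact_quo f g * g = f.
Proof. exact: (epsilon_spec (inhabits 0) (fun q => q * g = f)). Qed.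

(** The quotient defining [factorial_schur] is exact, since the Vandermonde product divides every
    alternant. The substitution is a ring morphism fixing each ['X_i], so it carries the product
    formula over. *)
Lemma twisted_schur_vdm (d : nat) (w : nat -> nat) (u : nat) (la : part d) :
  twisted_schur w u la * vdm rat d =
  alternant (fun i => fac_power (twist d w u) (bar_exp la i)).
Proof.
have facE : factorial_schur la * vdm apoly d =
    \det (\matrix_(i < d, j < d)
             \prod_(1 <= p < bar_part la i) ('X_j - (avar p)%:MP)).
  apply: exact_quoK.
  have [q qE] := vdm_dvd_alternant (fun i : 'I_d =>
     fac_power (fun l => (avar l)%:MP) (bar_exp la i) : {poly {mpoly apoly[d]}}).
  exists q; rewrite qE; congr (\det _); apply/matrixP=> i j; rewrite !mxE.
  by rewrite horner_fac_power bar_expS.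
pose F := aeval (twist d w u).
have -> : vdm rat d = xsubst F (vdm apoly d).
  rewrite rmorph_prod; apply: eq_bigr => i _ /=.
  rewrite rmorph_prod; apply: eq_bigr => j _ /=.
  by rewrite rmorphB /= !xsubstX.
rewrite /twisted_schur -[aeval _]/F -rmorphM /= facE -det_map_mx.
congr (\det _); apply/matrixP=> i j; rewrite !mxE.
rewrite rmorph_prod horner_fac_power bar_expS; apply: eq_bigr => p _ /=.
by rewrite rmorphB /= xsubstX xsubstC; congr (_ - _); apply: aeval_avar.
Qed.

(** * Linear spans *)

(** Indices may repeat in the list, so that a sum is a mere concatenation; [in_span_family] merges
    the repetitions. *)
Definition in_span (K : fieldType) (V : lmodType K) (I : Type) (b : I -> V)
    (v : V) : Prop :=
  exists s : seq (K * I), v = \sum_(x <- s) x.1 *: b x.2.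

Lemma in_span_gen (K : fieldType) (V : lmodType K) (I : Type) (b : I -> V) i :
  in_span b (b i).
Proof. by exists [:: (1, i)]; rewrite big_seq1 scale1r. Qed.

Lemma in_span0 (K : fieldType) (V : lmodType K) (I : Type) (b : I -> V) :
  in_span b 0.
Proof. by exists [::]; rewrite big_nil. Qed.

Lemma in_spanD (K : fieldType) (V : lmodType K) (I : Type) (b : I -> V) v w :
  in_span b v -> in_span b w -> in_span b (v + w).
Proof. by move=> [s ->] [t ->]; exists (s ++ t); rewrite big_cat. Qed.

Lemma in_spanZ (K : fieldType) (V : lmodType K) (I : Type) (b : I -> V) a v :
  in_span b v -> in_span b (a *: v).
Proof.
move=> [s ->]; exists [seq (a * x.1, x.2) | x <- s].
by rewrite big_map scaler_sumr; apply: eq_bigr => x _; rewrite scalerA.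
Qed.

Lemma in_span_family (K : fieldType) (V : lmodType K) (I : eqType) (b : I -> V)
    v : in_span b v ->
  exists (r : seq I) (c : I -> K), uniq r /\ v = \sum_(i <- r) c i *: b i.
Proof.
move=> [s ->]; exists (undup (map snd s)).
exists (fun i => \sum_(x <- s | x.2 == i) x.1); split; first exact: undup_uniq.
under [RHS]eq_bigr => i _ do rewrite scaler_suml.
rewrite (exchange_big_dep predT) //=; apply: eq_big_seq => x xs.
rewrite -big_filter (eq_filter (a2 := pred1 x.2)) => [|i]; last exact: eq_sym.
by rewrite filter_pred1_uniq ?undup_uniq ?mem_undup ?map_f // big_seq1.
Qed.

(** * Partitions and strictly decreasing sequences *)

Lemma bar_exp_dec (d : nat) (la : part d) (i j : 'I_d) :
  (i < j)%N -> (bar_exp la j < bar_exp la i)%N.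
Proof.
move=> ij; rewrite -ltnS !bar_expS /bar_part.
have geq_tr : transitive geq by move=> y x z /= yx zy; apply: leq_trans yx.
have := sorted_ltn_nth geq_tr 0%N (valP la) i j.
rewrite !inE size_tuple !ltn_ord -!tnth_nth => /(_ isT isT ij) /=.
by have := ltn_ord j; lia.
Qed.

(** A strictly decreasing sequence dominates the staircase [d-1, ..., 0]; subtracting the staircase
    leaves a partition. *)
Lemma bar_exp_onto (d : nat) (b : 'I_d -> nat) :
  (forall i j : 'I_d, (i < j)%N -> (b j < b i)%N) ->
  exists la : part d, bar_exp la =1 b.
Proof.
move=> bdec.
(* Induction from the last entry backwards, [k] being the distance to it. *)
have bge (k : nat) (i : 'I_d) : (d = i.+1 + k)%N -> (k <= b i)%N.
  elim: k i => // k IHk i di.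
  have lt_j : (i.+1 < d)%N by lia.
  have := IHk (Ordinal lt_j) _; have := bdec i (Ordinal lt_j) (ltnSn i).
  by move=> /= ? /(_ ltac:(lia)); lia.
have {}bge (i : 'I_d) : (d - i.+1 <= b i)%N.
  by apply: bge; have := ltn_ord i; lia.
pose t := [tuple (b i - (d - i.+1))%N | i < d].
have t_sorted : sorted geq t.
  apply/(sortedP 0%N) => i; rewrite size_tuple => lt_i.
  have := bdec (Ordinal (ltnW lt_i)) (Ordinal lt_i) (ltnSn i).
  have := bge (Ordinal lt_i).
  rewrite -(tnth_nth _ t (Ordinal lt_i)) -(tnth_nth _ t (Ordinal (ltnW lt_i))).
  by rewrite !tnth_mktuple /=; lia.
exists (exist _ t t_sorted) => i.
rewrite /bar_exp /bar_part /= tnth_mktuple.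
by have := ltn_ord i; have := bge i; lia.
Qed.

Lemma injective_sort_dec (d : nat) (b : 'I_d -> nat) : injective b ->
  exists s : 'S_d, forall i j : 'I_d, (i < j)%N -> (b (s j) < b (s i))%N.
Proof.
move=> binj; pose t := [tuple b i | i < d].
have /tuple_permP[s Es] : perm_eq (sort geq t) t by rewrite perm_sort.
have st : sorted gtn (sort geq t).
  rewrite gtn_sorted_uniq_geq sort_uniq sort_sorted ?andbT.
    by rewrite /t /= map_inj_uniq ?enum_uniq.
  by move=> x y; apply: leq_total.
exists s => i j ij.
have gtn_tr : transitive gtn by move=> y x z /= yx zy; apply: ltn_trans yx.
have := sorted_ltn_nth gtn_tr 0%N st i j.
rewrite Es !inE size_tuple !ltn_ord -!tnth_nth !tnth_mktuple.
by move=> /(_ isT isT ij).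
Qed.

(** * The Pieri rule and the reduction of power alternants *)

(** The span is multiplied by the Vandermonde product so that one can compute with determinants
    instead of quotients. *)
Definition in_alt (d : nat) (w : nat -> nat) (u : nat) (p : {mpoly rat[d]}) :=
  exists2 t, in_span (fun la : part d => twisted_schur w u la) t
    & p = t * vdm rat d.

Lemma in_alt0 (d : nat) (w : nat -> nat) (u : nat) : @in_alt d w u 0.
Proof. by exists 0; [exact: in_span0 | rewrite mul0r]. Qed.

Lemma in_altD (d : nat) (w : nat -> nat) (u : nat) (p q : {mpoly rat[d]}) :
  in_alt w u p -> in_alt w u q -> in_alt w u (p + q).
Proof.
move=> [t st ->] [t' st' ->]; exists (t + t'); last by rewrite mulrDl.
exact: in_spanD.
Qed.

Lemma in_altZ (d : nat) (w : nat -> nat) (u : nat) a (p : {mpoly rat[d]}) :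
  in_alt w u p -> in_alt w u (a *: p).
Proof.
move=> [t st ->]; exists (a *: t); last by rewrite scalerAl.
exact: in_spanZ.
Qed.

Lemma in_alt_sum (d : nat) (w : nat -> nat) (u : nat) (J : Type) (r : seq J)
    (P : pred J) (F : J -> {mpoly rat[d]}) :
  (forall j, P j -> in_alt w u (F j)) ->
  in_alt w u (\sum_(j <- r | P j) F j).
Proof.
by move=> bF; elim/big_ind: _ => //; [exact: in_alt0 | exact: in_altD].
Qed.

(** Distinct exponents can be sorted into those of a partition, at the cost of a sign; a repeated
    exponent makes the alternant vanish. *)
Lemma in_alt_fac (d : nat) (w : nat -> nat) (u : nat) (b : 'I_d -> nat) :
  in_alt w u (alternant (fun i => fac_power (twist d w u) (b i))).
Proof.
case: (boolP (injectiveb b)) => [/injectiveP binj | /injectivePn[i [j ij bij]]].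
  have [s bsdec] := injective_sort_dec binj.
  have [la laE] := bar_exp_onto bsdec.
  exists ((-1) ^+ s *: twisted_schur w u la).
    by apply: in_spanZ; apply: in_span_gen.
  rewrite -scalerAl twisted_schur_vdm.
  rewrite [in RHS](eq_alternant
    (g := (fun i => fac_power (twist d w u) (b i)) \o s)) => [|i].
    rewrite alternant_perm scaler_sign mulr_sign.
    by case: odd_perm; rewrite ?opprK.
  by rewrite /= laE.
rewrite (alternant_dup ij); first exact: in_alt0.
by rewrite bij.
Qed.

Lemma fac_powerS (R : comNzRingType) (v : nat -> R) (b : nat) :
  'X * fac_power v b = fac_power v b.+1 + (v b.+1)%:P * fac_power v b.
Proof.
rewrite /fac_power [in RHS]big_nat_recr //= mulrBr [X in X - _]mulrC.
by rewrite [X in _ - X]mulrC subrK.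
Qed.

Lemma in_alt_mul_sumX (d : nat) (w : nat -> nat) (u : nat)
    (p : {mpoly rat[d]}) :
  in_alt w u p -> in_alt w u ((\sum_(k < d) 'X_k) * p).
Proof.
move=> [_ [s ->] ->]; set e1 := \sum_(k < d) _.
rewrite [X in _ * X]mulr_suml mulr_sumr.
apply: in_alt_sum => -[a la] _ /=.
rewrite -scalerAl -scalerAr; apply: in_altZ; rewrite twisted_schur_vdm.
set f := fun i => _.
(* The terms of [fac_powerS] with factor [twist] are multiples of [e1 * alternant f]; [c] collects
   them on the left-hand side. *)
pose c : rat := \sum_(i < d) (w (bar_exp la i).+1)%:R / u%:R.
have c_ge0 : 0 <= c.
  by apply: sumr_ge0 => i _; rewrite divr_ge0 ?ler0n.
have pieri : (1 + c) *: (e1 * alternant f) =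
    \sum_(i < d)
      alternant (upd f i (fac_power (twist d w u) (bar_exp la i).+1)).
  rewrite scalerDl scale1r -{1}alternant_sum_mulX.
  rewrite scaler_suml -big_split; apply: eq_bigr => i _ /=.
  rewrite {1}/f fac_powerS alternant_upd_linear -addrA -[RHS]addr0.
  congr (_ + _).
  rewrite (eq_alternant (g := f)) => [|k]; last first.
    by rewrite /upd; case: eqP => [->|].
  by rewrite /twist -/e1 -scalerAl -scalerDl addNr scale0r.
(* The nonnegativity of [w] makes the Pieri rule solvable for [e1 * alternant f]. *)
have c1 : 1 + c != 0 by rewrite gt_eqF // ltr_wpDr.
rewrite -[e1 * _](scalerK c1) pieri; apply: in_altZ; apply: in_alt_sum => i _.
rewrite (eq_alternant (g := fun k => fac_power (twist d w u)
           (upd (bar_exp la) i (bar_exp la i).+1 k))).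
  exact: in_alt_fac.
by move=> k; rewrite /upd /f; case: ifP.
Qed.

(** Induction on the number of plain factors ['X]. By [fac_powerS], one such factor is either
    absorbed into the factorial power of its row or replaced by a multiple of the sum of the
    variables, which leaves the determinant and is harmless by [in_alt_mul_sumX]. *)
Lemma in_alt_Xn_fac (d : nat) (w : nat -> nat) (u : nat) (a b : 'I_d -> nat) :
  in_alt w u (alternant (fun i => 'X^(a i) * fac_power (twist d w u) (b i))).
Proof.
have [n] := ubnP (\sum_i a i)%N; elim: n => // n IHn in a b *.
rewrite ltnS => le_an.
case: (pickP (fun i => a i != 0%N)) => [i ai_neq0 | a0]; last first.
  rewrite (eq_alternant (g := fun i => fac_power (twist d w u) (b i))).
    exact: in_alt_fac.
  by move=> i; have /negbFE/eqP-> := a0 i; rewrite mul1r.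
pose a' := upd a i (a i).-1.
have lt_a'n : (\sum_i a' i < n)%N.
  apply: leq_trans le_an; rewrite (bigD1 i) //= [X in (_ < X)%N](bigD1 i) //=.
  rewrite {1}/a' /upd eqxx (eq_bigr a) => [|k /negbTE].
    by lia.
  by rewrite /a' /upd => ->.
pose f := fun k => 'X^(a' k) * fac_power (twist d w u) (b k).
pose b' := upd b i (b i).+1.
rewrite (eq_alternant (g := upd f i
    ('X^(a' i) * fac_power (twist d w u) (b' i) +
      (twist d w u (b i).+1)%:P * f i))); last first.
  move=> k; rewrite /upd /f; case: eqP => [->|/eqP/negbTE ki]; last first.
    by rewrite /a' /upd ki.
  rewrite mulrCA -mulrDr /b' /upd eqxx -fac_powerS mulrA -exprSr.
  by rewrite /a' /upd eqxx prednK ?lt0n.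
rewrite alternant_upd_linear; apply: in_altD.
  rewrite (eq_alternant
    (g := fun k => 'X^(a' k) * fac_power (twist d w u) (b' k))).
    exact: IHn.
  by move=> k; rewrite /b' /f /upd eqxx; case: eqP => [->|].
rewrite /twist -scalerAl; apply/in_altZ/in_alt_mul_sumX.
rewrite (eq_alternant (g := f)); first exact: IHn.
by move=> k; rewrite /upd; case: eqP => [->|].
Qed.

(** The Leibniz expansion is the antisymmetrisation of a monomial. *)
Lemma alternant_Xn (R : comNzRingType) (d : nat) (m : 'X_{1..d}) :
  alternant (fun i => 'X^(m i)) =
  \sum_(s : 'S_d) (-1) ^+ s *: msym s 'X_[m] :> {mpoly R[d]}.
Proof.
apply: eq_bigr => s _.
have -> : (-1) ^+ s *: msym s 'X_[m] =
    (-1) ^+ s * msym s 'X_[m] :> {mpoly R[d]}.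
  by rewrite scaler_sign mulr_sign.
congr (_ * _); rewrite /msym mmapX; apply: eq_bigr => i _.
by rewrite !mxE hornerXn.
Qed.

Lemma in_alt_Xn (d : nat) (w : nat -> nat) (u : nat) (m : 'X_{1..d}) :
  in_alt w u (alternant (fun i => 'X^(m i))).
Proof.
rewrite (eq_alternant (g := fun i => 'X^(m i) * fac_power (twist d w u) 0)).
  exact: in_alt_Xn_fac.
by move=> i; rewrite /fac_power big_geq ?mulr1.
Qed.

(** * Symmetry and spanning *)

Lemma vdm_neq0 (d : nat) : vdm rat d != 0.
Proof.
apply/prodf_neq0 => i _; apply/prodf_neq0 => j ij.
rewrite subr_eq0; apply/eqP => /(congr1 (mcoeff U_(i))).
rewrite !mcoeffX !eqxx; case: eqP => // /mnmP/(_ i).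
by rewrite !mnm1E eqxx -val_eqE /= gtn_eqF.
Qed.

Lemma vdm_inj (d : nat) : injective (fun p => p * vdm rat d).
Proof. by move=> p q; apply: mulIf; apply: vdm_neq0. Qed.

Lemma msym_twist (d : nat) (w : nat -> nat) (u l : nat) (s : 'S_d) :
  msym s (twist d w u l) = twist d w u l.
Proof.
rewrite /twist msymZ; congr (_ *: _); rewrite raddf_sum /=.
rewrite [RHS](reindex_inj (@perm_inj _ s)); apply: eq_bigr => k _ /=.
by rewrite /msym mmapX mmap1U.
Qed.

(** The alternant and the Vandermonde product change by the same sign, and the latter can be
    cancelled. *)
Lemma twisted_schur_sym (d : nat) (w : nat -> nat) (u : nat) (la : part d) :
  twisted_schur w u la \is symmetric.
Proof.
apply/issymP => s; apply: vdm_inj => /=; rewrite twisted_schur_vdm.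
have := msym_vdm rat s; move/(congr1 (fun p => (-1) ^+ s * p)).
rewrite mulrA -signr_addb addbb mul1r => <-.
rewrite mulrCA -msymM twisted_schur_vdm msym_alternant.
  by rewrite mulrA -signr_addb addbb mul1r.
move=> i; rewrite /fac_power rmorph_prod; apply: eq_bigr => p _ /=.
by rewrite rmorphB /= map_polyX map_polyC /= msym_twist.
Qed.

(** The product of [p] with the Vandermonde product is alternating, hence the average of its signed
    permutations. Expanded in monomials, this average is a combination of alternants of powers. *)
Lemma twisted_schur_span (d : nat) (w : nat -> nat) (u : nat)
    (p : {mpoly rat[d]}) :
  p \is symmetric -> in_span (fun la : part d => twisted_schur w u la) p.
Proof.
move=> /issymP psym; suff [t spt /vdm_inj->] : in_alt w u (p * vdm rat d) by [].
set q := p * _.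
have fact_neq0 : (d`!)%:R != 0 :> rat by rewrite pnatr_eq0 -lt0n fact_gt0.
have <- : (d`!)%:R^-1 *: \sum_(s : 'S_d) (-1) ^+ s *: msym s q = q.
  rewrite (eq_bigr (fun=> q)) => [|s _].
    by rewrite sumr_const card_Sn -scaler_nat scalerA mulVf // scale1r.
  rewrite /q msymM psym msym_vdm scaler_sign mulr_sign.
  by case: odd_perm; rewrite // mulrN opprK.
rewrite (eq_bigr (fun s : 'S_d => \sum_(m <- msupp q)
    q@_m *: ((-1) ^+ s *: msym s 'X_[m]))) => [|s _].
  apply: in_altZ; rewrite exchange_big; apply: in_alt_sum => m _ /=.
  by rewrite -scaler_sumr -alternant_Xn; apply/in_altZ/in_alt_Xn.
rewrite {1}[q]mpolyE [msym s _]raddf_sum scaler_sumr; apply: eq_bigr => m _ /=.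
by rewrite msymZ !scalerA mulrC.
Qed.

(** * Linear independence, degree by degree *)

Definition bar_mnm (d : nat) (la : part d) : 'X_{1..d} :=
  [multinom bar_exp la i | i < d].

Lemma bar_exp_inj (d : nat) (la mu : part d) :
  bar_exp la =1 bar_exp mu -> la = mu.
Proof.
move=> eq_lm; apply/val_inj/eq_from_tnth => i.
have := congr1 S (eq_lm i); rewrite !bar_expS /bar_part.
exact: addIn.
Qed.

(** A strictly decreasing sequence is determined by its set of values, and no nontrivial permutation
    fixes it. *)
Lemma bar_mnm_perm (d : nat) (la mu : part d) (s : 'S_d) :
  bar_mnm la = [multinom bar_mnm mu (s i) | i < d] -> la = mu /\ s = 1%g.
Proof.
move=> /mnmP eq_s; have {}eq_s i : bar_exp la i = bar_exp mu (s i).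
  by have := eq_s i; rewrite !mnmE.
have sorted_bar nu : sorted gtn [tuple bar_exp nu i | i < d].
  apply/(sortedP 0%N) => i; rewrite size_tuple => lt_i.
  rewrite -(tnth_nth _ _ (Ordinal lt_i)) -(tnth_nth _ _ (Ordinal (ltnW lt_i))).
  by rewrite !tnth_mktuple; apply: bar_exp_dec.
have la_mu : la = mu.
  apply: bar_exp_inj => i.
  rewrite -(tnth_mktuple (bar_exp la)) -(tnth_mktuple (bar_exp mu)).
  congr (tnth _ i); apply: val_inj; apply: (irr_sorted_eq (leT := gtn)) => //.
  - by move=> y x z /= yx zy; apply: ltn_trans yx.
  - by move=> x /=; rewrite ltnn.
  - exact: sorted_bar.
  - exact: sorted_bar.
  move=> x; apply/tnthP/tnthP => -[j ->]; rewrite !tnth_mktuple.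
    by exists (s j); rewrite tnth_mktuple.
  by exists (s^-1 j)%g; rewrite tnth_mktuple eq_s permKV.
split=> //; apply/permP => i; rewrite perm1; apply: val_inj.
have eq_i : bar_exp mu i = bar_exp mu (s i) by rewrite -eq_s la_mu.
by case: (ltngtP (s i) i) => // /(bar_exp_dec mu); rewrite eq_i ltnn.
Qed.

Lemma mcoeff_alternant_bar (d : nat) (la mu : part d) :
  (alternant (fun i => 'X^(bar_mnm la i)) : {mpoly rat[d]})@_(bar_mnm mu) =
  (la == mu)%:R.
Proof.
rewrite alternant_Xn raddf_sum /= (bigD1 1%g) //= big1 => [|s s1].
  rewrite odd_perm1 scale1r msym1m mcoeffX addr0; congr (_ : bool)%:R.
  apply/eqP/eqP => [/mnmP eq_lm | -> //].
  by apply: bar_exp_inj => i; have := eq_lm i; rewrite !mnmE.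
rewrite mcoeffZ mcoeff_sym mcoeffX; case: eqP => [/bar_mnm_perm[_ s_1]|].
  by rewrite s_1 eqxx in s1.
by rewrite mulr0.
Qed.

Lemma dhomog_big_prod (R : comNzRingType) (d : nat) (I : Type) (r : seq I)
    (F : I -> {mpoly R[d]}) (n : I -> nat) :
  (forall i, F i \is (n i).-homog) ->
  \prod_(i <- r) F i \is (\sum_(i <- r) n i)%N.-homog.
Proof.
move=> homF; elim/big_rec2: _ => [|i m p _ homp]; first exact: dhomog1.
exact: dhomogM.
Qed.

Lemma dhomog_sumX (R : comNzRingType) (d : nat) :
  \sum_(k < d) ('X_k : {mpoly R[d]}) \is 1.-homog.
Proof. by apply: rpred_sum => k _; rewrite dhomogX /= mdeg1. Qed.

(** The substituted parameters are linear forms, so a factorial power with [b] factors, evaluated at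
    a variable, is homogeneous of degree [b]. *)
Lemma twisted_schur_vdm_homog (d : nat) (w : nat -> nat) (u : nat)
    (la : part d) :
  twisted_schur w u la * vdm rat d \is (mdeg (bar_mnm la)).-homog.
Proof.
rewrite twisted_schur_vdm mdegE; apply: rpred_sum => s _.
rewrite mulr_sign; case: odd_perm; rewrite ?rpredN.
all: apply: dhomog_big_prod => i; rewrite !mxE horner_fac_power mnmE.
(* The degree is rewritten as a sum of ones over the factors. *)
all: rewrite -[X in X.-homog]muln1 -[X in (X * 1)%N](subn1 (bar_exp la i).+1).
all: rewrite -sum_nat_const_nat; apply: dhomog_big_prod => p.
all: by rewrite rpredB ?dhomogX /= ?mdeg1 // rpredZ // dhomog_sumX.
Qed.

Lemma mcoeff_twisted_schur_vdm0 (d : nat) (w : nat -> nat) (u : nat)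
    (la mu : part d) : mdeg (bar_mnm la) != mdeg (bar_mnm mu) ->
  (twisted_schur w u la * vdm rat d)@_(bar_mnm mu) = 0.
Proof.
move=> neq; apply: dhomog_nemf_coeff (twisted_schur_vdm_homog w u la) _.
by rewrite eq_sym.
Qed.

(** The parts of such a partition are at most [n], so a finite enumeration of tuples suffices. *)
Lemma part_of_degree (d n : nat) :
  exists2 S : seq (part d), uniq S &
    forall la, (la \in S) = (mdeg (bar_mnm la) == n).
Proof.
pose all_t := [seq map_tuple val t | t : d.-tuple 'I_n.+1].
exists [seq la <- undup (pmap (insub : d.-tuple nat -> option (part d)) all_t)
          | mdeg (bar_mnm la) == n].
  by rewrite filter_uniq // undup_uniq.
move=> la; rewrite mem_filter mem_undup andb_idr // => /eqP deg_la.
rewrite mem_pmap_sub; apply/mapP.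
exists [tuple inord (tnth (val la) i) | i < d]; first by rewrite mem_enum.
apply: eq_from_tnth => i.
rewrite tnth_map tnth_mktuple /= inordK // ltnS -deg_la.
rewrite mdegE (bigD1 i) //= mnmE; apply: leq_trans (leq_addr _ _).
by rewrite -ltnS bar_expS /bar_part -[X in (X < _)%N]addn0 ltn_add2l subn_gt0.
Qed.

Lemma big_seq_tnth_support (R : comNzRingType) (I : eqType) (r s : seq I)
    (c F : I -> R) :
  uniq r -> uniq s -> (forall i, i \notin s -> F i = 0) ->
  \sum_(i <- r) c i * F i =
  \sum_(k < size s) (if tnth (in_tuple s) k \in r then c (tnth (in_tuple s) k)
                     else 0) * F (tnth (in_tuple s) k).
Proof.
move=> uniq_r uniq_s F0.
rewrite -(big_tnth _ _ s xpredT (fun i => (if i \in r then c i else 0) * F i)).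
transitivity (\sum_(i <- r | i \in s) c i * F i).
  rewrite [RHS]big_mkcond; apply: eq_bigr => i _.
  by case: ifPn => // /F0->; rewrite mulr0.
transitivity (\sum_(i <- s | i \in r) c i * F i); last first.
  rewrite big_mkcond; apply: eq_bigr => i _.
  by case: ifP => //; rewrite mul0r.
rewrite -big_filter -[RHS]big_filter; apply: perm_big.
by apply: uniq_perm; rewrite ?filter_uniq // => i; rewrite !mem_filter andbC.
Qed.

(** Only the finitely many partitions with the degree of [la] matter. On these, [K] expresses
    twisted polynomials in Schur polynomials; it is square, and spanning yields a left inverse. *)
Lemma twisted_schur_free (d : nat) (w : nat -> nat) (u : nat)
    (r : seq (part d)) (c : part d -> rat) : uniq r ->
  \sum_(la <- r) c la *: twisted_schur w u la = 0 ->
  forall la, la \in r -> c la = 0.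
Proof.
move=> uniq_r sum0 la la_r.
have [S uniq_S memS] := part_of_degree d (mdeg (bar_mnm la)).
pose sh (k : 'I_(size S)) := tnth (in_tuple S) k.
have sh_deg k : mdeg (bar_mnm (sh k)) = mdeg (bar_mnm la).
  by apply/eqP; rewrite -memS mem_tnth.
(* For symmetric [p] this is the coefficient of [p] at the Schur polynomial of [mu]. *)
pose phi mu p := (p * vdm rat d)@_(bar_mnm mu).
pose K := \matrix_(i, j) phi (sh j) (twisted_schur w u (sh i)).
have phi_sum (r' : seq (part d)) c' j : uniq r' ->
    phi (sh j) (\sum_(mu <- r') c' mu *: twisted_schur w u mu) =
    ((\row_k (if sh k \in r' then c' (sh k) else 0)) *m K) 0 j.
  move=> uniq_r'; rewrite /phi mulr_suml raddf_sum /= mxE.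
  under eq_bigr => mu _ do rewrite -scalerAl mcoeffZ.
  rewrite (big_seq_tnth_support _ uniq_r' uniq_S) => [|mu].
    by apply: eq_bigr => k _; rewrite !mxE.
  rewrite memS => deg_mu; apply: mcoeff_twisted_schur_vdm0.
  by rewrite sh_deg.
(* Row [i] of the inverse expands the power alternant of [sh i]; by [phi_sum], terms of other
   degrees do not contribute. *)
have [C CK] : exists C : 'I_(size S) -> 'rV[rat]_(size S),
    forall i, C i *m K = delta_mx 0 i.
  apply: (fin_all_exists
    (P := fun i (Ci : 'rV_(size S)) => Ci *m K = delta_mx 0 i)) => i.
  have [t /in_span_family[r' [c' [uniq_r' ->]]] eq_t] :=
    in_alt_Xn w u (bar_mnm (sh i)).
  exists (\row_k (if sh k \in r' then c' (sh k) else 0)).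
  apply/rowP => j; rewrite -phi_sum // /phi -eq_t mcoeff_alternant_bar !mxE.
  rewrite eqxx /= eq_sym /sh !(tnth_nth la) /= nth_uniq //.
have /mulmx1C KC : (\matrix_i C i) *m K = 1%:M.
  by apply/row_matrixP => i; rewrite row_mul rowK CK row1.
pose v : 'rV_(size S) := \row_k (if sh k \in r then c (sh k) else 0).
have vK : v *m K = 0.
  apply/rowP => j; rewrite -phi_sum // sum0 /phi mul0r mcoeff0.
  by rewrite mxE.
have v0 : v = 0 by rewrite -[v]mulmx1 -KC mulmxA vK mul0mx.
have la_S : la \in S by rewrite memS.
have lt_la : (index la S < size S)%N by rewrite index_mem.
have := congr1 (fun x : 'rV_(size S) => x 0 (Ordinal lt_la)) v0.
by rewrite !mxE /sh (tnth_nth la) /= nth_index // la_r.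
Qed.

(* w l stands for the l-th term of the sequence, l >= 1; w 0 plays no role. *)
Theorem proposition5p3 (d : nat) (hd : (0 < d)%N) (w : nat -> nat)
    (u : nat) (hu : (0 < u)%N) :
  is_basis [pred p : {mpoly rat[d]} | p \is symmetric]
           (fun la : part d => twisted_schur w u la).
Proof.
split=> [la | r c | p]; first exact: twisted_schur_sym.
  exact: twisted_schur_free.
move=> /(twisted_schur_span w u)/in_span_family[r [c [_ p_rc]]].
by exists r, c.
Qed.
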